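(* Let $\Omega\subseteq\mathbb{R}$ be a domain, let $1\le p\le\infty$, and fix a time $t$. Let $w(\cdot,t)\ge 0$ be a probability density on $\Omega$ and let $$u(x,t)=\int_\Omega H(x-y)\,w(y,t)\,dy,\qquad x\in\Omega,$$ be its cumulative distribution function (so $u(\cdot,t)$ is nondecreasing with $w=\partial u/\partial x$). Let $X_1,\dots,X_N$ be i.i.d. random variables with density $w(\cdot,t)$. Then the empirical cumulative distribution function $$u_N(x,t)=\frac1N\sum_{k=1}^N H(x-X_k)$$ satisfies $$\|u(\cdot,t)-u_N(\cdot,t)\|_{L^p(\Omega,L^2(\Omega))}\le\frac{\|u(\cdot,t)\|_{L^{p/2}(\Omega)}^{1/2}}{N^{1/2}} .$$
   Context: $H$ is the right-continuous Heaviside function: $H(x)=0$ for $x<0$ and $H(x)=1$ for $x\ge 0$. For a random function $g$ on $\Omega$, $\|g\|_{L^p(\Omega,L^2(\Omega))}:=\big\|\,\mathbb{E}[g^2]^{1/2}\,\big\|_{L^p(\Omega)}$, where $\mathbb{E}$ is the expectation with respect to the random samples $X_1,\dots,X_N$ (taken pointwise in $x\in\Omega$). For $r=p/2>0$, $\|u\|_{L^{r}(\Omega)}:=\big(\int_\Omega |u|^{r}\,dx\big)^{1/r}$ also when $r<1$ (a quasi-norm), with the essential supremum if $p=\infty$; norms may be $+\infty$. *)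

(* Defs.v *)
From HB Require Import structures.
From mathcomp Require Import all_boot all_order all_algebra.
From mathcomp Require Import all_classical all_reals all_analysis.

Set Implicit Arguments.
Unset Strict Implicit.
Unset Printing Implicit Defensive.

Import Order.TTheory GRing.Theory Num.Theory.
Import numFieldNormedType.Exports.

Local Open Scope classical_set_scope.
Local Open Scope ring_scope.

Definition domain (R : realType) (Omega : set R) : Prop :=
  [/\ open Omega, connected Omega & Omega !=set0].

Definition heaviside (R : realType) (x : R) : R := if 0 <= x then 1 else 0.

(* [w] is only constrained on [Omega]; measurability is Borel measurability. *)
Definition probability_density (R : realType) (Omega : set R) (w : R -> R) :
    Prop :=
  [/\ measurable_fun Omega w,
      forall x, Omega x -> 0 <= w x &
      (\int[lebesgue_measure]_(x in Omega) (w x)%:E = 1)%E].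

Definition density_cdf (R : realType) (Omega : set R) (w : R -> R) (x : R) : R :=
  \int[lebesgue_measure]_(y in Omega) (heaviside (x - y) * w y).

Definition has_density (d : measure_display) (T : measurableType d)
    (R : realType) (P : probability T R) (X : {RV P >-> R})
    (Omega : set R) (w : R -> R) : Prop :=
  forall A : set R, measurable A ->
    (distribution P X A =
     \int[lebesgue_measure]_(y in Omega `&` A) (w y)%:E)%E.

Definition mutually_independent (d d' : measure_display) (T : measurableType d)
    (T' : measurableType d') (R : realType) (P : probability T R) (I : finType)
    (X : I -> {RV P >-> T'}) : Prop :=
  forall (J : {set I}) (A : I -> set T'), (forall i, measurable (A i)) ->
    (P (\bigcap_(i in [set` J]) (X i @^-1` A i)) =
     \prod_(i in J) P (X i @^-1` A i))%E.

Definition empirical_cdf (d : measure_display) (T : measurableType d)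
    (R : realType) (P : probability T R) (N : nat) (X : 'I_N -> {RV P >-> R})
    (x : R) (s : T) : R :=
  N%:R^-1 * \sum_(k < N) heaviside (x - X k s).

(* The norm of L^p(Omega) is computed on the extension of [f] by zero, which has
   the same integral of |f|^p, and the same essential supremum of |f| when
   [Omega] is not empty. It is a quasi-norm for 0 < p < 1, and takes the value
   +oo when [f] is not in L^p(Omega). *)
Definition Lp_norm (R : realType) (Omega : set R) (p : \bar R)
    (f : R -> \bar R) : \bar R :=
  'N[lebesgue_measure]_p[f \_ Omega]%E.

(* [s] ranges over the sample space, [x] over the spatial domain [Omega]. *)
Definition Lp_L2_norm (d : measure_display) (T : measurableType d)
    (R : realType) (P : probability T R) (Omega : set R) (p : \bar R)
    (g : R -> T -> R) : \bar R :=
  Lp_norm Omega p (fun x => ('E_P[(fun s => g x s ^+ 2)%R] `^ 2^-1)%E).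

(* Main.v *)
(* For fixed x, the indicators of the events X_k <= x are pairwise independent
   and have mean q = u(x), so E[(u(x) - u_N(x))^2] = q (1 - q) / N <= u(x) / N.
   Taking square roots and the L^p norm over Omega gives the bound, because
   the L^p norm of u^(1/2) is the square root of the L^(p/2) norm of u. *)
Require Import Defs.
From HB Require Import structures.
From mathcomp Require Import all_boot all_order all_algebra.
From mathcomp Require Import all_classical all_reals all_analysis.
From mathcomp Require Import ess_sup_inf measurable_realfun ring.

Import Order.TTheory GRing.Theory Num.Theory.
Import numFieldNormedType.Exports.

Local Open Scope classical_set_scope.
Local Open Scope ring_scope.

Lemma Lfun1_indic (d : measure_display) (T : measurableType d)
    (R : realType) (P : probability T R) (A : set T) :
  measurable A -> (\1_A : T -> R) \in Lfun P 1.
Proof. by move=> mA; apply/Lfun1_integrable; exact: integrable_indic. Qed.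

(** The operations on functions on the right are the form to which closure of [Lfun P 1] and
    linearity of the expectation apply directly. *)
Lemma indicB_mulE (T : Type) (R : realType) (A B : set T) (q : R) :
  (fun s => (q - \1_A s) * (q - \1_B s)) =
  ((\1_(A `&` B) \+ cst (q ^+ 2)) \- (q \o* \1_A)) \- (q \o* \1_B).
Proof. by apply/funext => s /=; rewrite indicI/=; ring. Qed.

Lemma Lfun1_indicB_mul (d : measure_display) (T : measurableType d)
    (R : realType) (P : probability T R) (A B : set T) (q : R) :
  measurable A -> measurable B ->
  (fun s => (q - \1_A s) * (q - \1_B s)) \in Lfun P 1.
Proof.
move=> mA mB; rewrite indicB_mulE !rpredB ?rpredD ?Lfun_scale ?Lfun_cst//.
all: by apply: Lfun1_indic => //; exact: measurableI.
Qed.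

(** By linearity the constant and the two cross terms add up to [- q ^+ 2]. The probability of the
    intersection is left unevaluated, so that one formula serves both [A = B], giving the variance
    [q * (1 - q)], and independent events, giving 0. *)
Lemma expectation_indicB_mul (d : measure_display) (T : measurableType d)
    (R : realType) (P : probability T R) (A B : set T) (q : R) :
  measurable A -> measurable B -> P A = q%:E -> P B = q%:E ->
  ('E_P[fun s => ((q - \1_A s) * (q - \1_B s))%R] =
   P (A `&` B) - (q ^+ 2)%:E)%E.
Proof.
move=> mA mB PA PB; have mAB : measurable (A `&` B) by exact: measurableI.
have LZ C : measurable C -> q \o* (\1_C : T -> R) \in Lfun P 1.
  by move=> mC; rewrite Lfun_scale// Lfun1_indic.
have Lcst : cst (q ^+ 2) \in Lfun P 1 by exact: Lfun_cst.
rewrite indicB_mulE !expectationB ?expectationD ?rpredB ?rpredD ?Lfun1_indic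
  ?LZ//.
rewrite expectation_cst !expectationZl ?Lfun1_indic// !expectation_indic// PA PB.
have /fineK <- : P (A `&` B) \is a fin_num by exact: fin_num_measure.
by rewrite -!EFinM -!(EFinD, EFinN, EFinB); congr EFin; ring.
Qed.

(* Only the diagonal terms of the squared sum survive. *)
Lemma mean_square_error_frequency (d : measure_display) (T : measurableType d)
    (R : realType) (P : probability T R) (N : nat) (A : 'I_N -> set T) (q : R) :
  (0 < N)%N -> (forall k, measurable (A k)) -> (forall k, P (A k) = q%:E) ->
  (forall j k, j != k -> P (A j `&` A k) = (P (A j) * P (A k))%E) ->
  ('E_P[fun s => ((q - N%:R^-1 * \sum_(k < N) \1_(A k) s) ^+ 2)%R] =
  (q * (1 - q) / N%:R)%:E)%E.
Proof.
move=> N0 mA PA indA.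
have N0' : N%:R != 0 :> R by rewrite pnatr_eq0 -lt0n.
(* As [q] is the mean of [N] copies of itself, the error is the mean of the [q - \1_(A k) s], and
   its square is a sum over pairs of indices. *)
have E s : (q - N%:R^-1 * \sum_(k < N) \1_(A k) s) ^+ 2 =
    N%:R ^- 2 * \sum_(i : 'I_N * 'I_N)
      ((q - \1_(A i.1) s) * (q - \1_(A i.2) s)) :> R.
  rewrite -(pair_bigA _ (fun j k => (q - \1_(A j) s) * (q - \1_(A k) s)))/=.
  rewrite -big_distrlr/= -expr2 -exprVn -exprMn; congr (_ ^+ 2).
  by rewrite sumrB sumr_const card_ord -mulr_natl; field.
have Lf (i : 'I_N * 'I_N) :
    P.-integrable setT
      (fun s => ((q - \1_(A i.1) s) * (q - \1_(A i.2) s))%:E).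
  by apply/Lfun1_integrable; exact: Lfun1_indicB_mul.
rewrite unlock; under eq_integral do rewrite E EFinM -sumEFin.
rewrite integralZl ?integral_sum//; last exact: integrable_sum.
transitivity ((N%:R ^- 2)%:E *
    \sum_(i : 'I_N * 'I_N) ((i.1 == i.2)%:R * (q * (1 - q)))%:E)%E.
  congr (_ * _)%E; apply: eq_bigr => -[j k] _.
  have := @expectation_indicB_mul _ _ _ P (A j) (A k) q
    (mA j) (mA k) (PA j) (PA k).
  rewrite unlock /= => ->.
  have [->|jk] := eqVneq j k.
    by rewrite setIid PA -EFinB mul1r; congr EFin; ring.
  by rewrite indA// !PA -EFinM -EFinB mul0r; congr EFin; ring.
rewrite sumEFin -EFinM; congr EFin.
(* Row [j] keeps only its entry at [k = j], so the double sum is [N] times [q * (1 - q)]; with the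
   factor [N%:R ^- 2] a single [N%:R^-1] is left. *)
rewrite -(pair_bigA _ (fun j k : 'I_N => (j == k)%:R * (q * (1 - q))))/=.
under eq_bigr => j _.
  rewrite (bigD1 j)//= big1 ?addr0 ?eqxx ?mul1r; last first.
    by move=> k /negbTE; rewrite eq_sym => ->; rewrite mul0r.
  over.
by rewrite sumr_const card_ord -mulr_natl; field.
Qed.

(** [heaviside (x - y)] is the indicator of [y <= x], so the integral is the mass that the density
    gives to the half-line. This mass is finite, hence the real-valued integral is its true value
    and not a default. *)
Lemma density_cdfE (d : measure_display) (T : measurableType d)
    (R : realType) (P : probability T R) (X : {RV P >-> R})
    (Omega : set R) (w : R -> R) (x : R) :
  has_density X Omega w ->
  (density_cdf Omega w x)%:E = P (X @^-1` [set` `]-oo, x]]).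
Proof.
move=> hX; rewrite /density_cdf /Rintegral.
have E : (\int[lebesgue_measure]_(y in Omega) (heaviside (x - y) * w y)%:E =
    P (X @^-1` [set` `]-oo, x]]))%E.
  have := hX [set` `]-oo, x]] (measurable_itv _).
  rewrite /distribution /pushforward => ->.
  rewrite integral_mkcondr; apply: eq_integral => y _.
  rewrite patchE mem_setE /heaviside subr_ge0 in_itv/=.
  by case: ifP; rewrite ?mul1r ?mul0r.
by rewrite E fineK// fin_num_measure//; exact: measurable_funPTI.
Qed.

Lemma le_poweR (R : realType) (r : R) (x y : \bar R) :
  0 <= r -> (0 <= x)%E -> (x <= y)%E -> (x `^ r <= y `^ r)%E.
Proof.
move=> r0 x0 xy; apply: gt0_ler_poweR => //; rewrite in_itv/= leey andbT//.
exact: le_trans xy.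
Qed.

(** For finite [p], raising the pointwise bound to the power [p] turns the square root of [u] into
    its power [p / 2]; it remains to integrate and take the [p]-th root. Only monotonicity enters,
    so [p / 2] may lie below 1, where the triangle inequality fails. *)
Lemma Lnorm_le_sqrt (d : measure_display) (T : measurableType d)
    (R : realType) (mu : {measure set T -> \bar R}) (p : \bar R)
    (f u : T -> \bar R) (c : R) :
  measurable_fun setT f -> measurable_fun setT u -> (0 < p)%E -> 0 <= c ->
  (forall x, (`|f x| <= `|u x| `^ 2^-1 * c%:E)%E) ->
  ('N[mu]_p[f] <= 'N[mu]_(p / 2%:E)[u] `^ 2^-1 * c%:E)%E.
Proof.
move=> mf mes_u p0 c0 fu; have c0' : (0 <= c%:E)%E by rewrite lee_fin.
have mpow (g : T -> \bar R) (r : R) : measurable_fun setT g ->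
    measurable_fun setT (fun x => `|g x| `^ r)%E.
  move=> mg; apply: (measurableT_comp (measurable_poweR r)).
  exact: measurableT_comp.
case: p p0 => [r| |]//; last first.
  (* For [p = +oo], [p / 2] is again [+oo], and [u] is almost everywhere bounded by its essential
     supremum. On a space of measure zero this norm is 0 by convention. *)
  move=> _; rewrite inver pnatr_eq0/= gt0_mulye ?lte_fin ?invr_gt0//.
  rewrite unlock; case: ifPn => [_|_]; last first.
    by rewrite mule_ge0// poweR_ge0.
  apply/ess_supP; near=> x; apply: (le_trans (fu x)).
  rewrite lee_wpmul2r//.
  have ux : (`|u x| <= ess_sup mu (abse \o u))%E.
    by near: x; exact: ess_sup_ge.
  by apply: le_poweR.
rewrite lte_fin => r0; rewrite inver pnatr_eq0/= -EFinM unlock.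
rewrite -poweRrM invfM invrK mulfK//.
(* Writing [c] as an [r]-th root puts both sides under the power [r^-1], so that comparing the
   integrals suffices. *)
rewrite (_ : c%:E = (c%:E `^ r) `^ r^-1)%E; last first.
  by rewrite -poweRrM mulfV ?lt0r_neq0// poweRe1.
rewrite -poweRM ?poweR_ge0//; last first.
  by apply: integral_ge0 => x _; exact: poweR_ge0.
rewrite -ge0_integralZr ?poweR_ge0//; last 2 first.
- exact: mpow.
- by move=> x _; exact: poweR_ge0.
have le_int : (\int[mu]_x `|f x| `^ r <=
    \int[mu]_x (`|u x| `^ (r / 2) * c%:E `^ r))%E.
  apply: ge0_le_integral => //.
  - by move=> x _; exact: poweR_ge0.
  - exact: mpow.
  - by apply: emeasurable_funM; [exact: mpow|exact: measurable_cst].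
  - move=> x _; rewrite (mulrC r) (poweRrM _ 2^-1) -poweRM ?poweR_ge0//.
    by apply: le_poweR => //; exact: ltW.
have int_ge0 : (0 <= \int[mu]_x `|f x| `^ r)%E.
  by apply: integral_ge0 => x _; exact: poweR_ge0.
by apply: le_poweR => //; rewrite invr_ge0 ltW.
Unshelve. all: by end_near. Qed.

Theorem theorem3 (R : realType) (Omega : set R) (hOmega : domain Omega)
    (p : \bar R) (hp : (1 <= p)%E) (w : R -> R -> R) (t : R)
    (hw : probability_density Omega (w ^~ t))
    (d : measure_display) (T : measurableType d) (P : probability T R)
    (N : nat) (hN : (0 < N)%N) (X : 'I_N -> {RV P >-> R})
    (hX : forall k, has_density (X k) Omega (w ^~ t))
    (hind : mutually_independent X) :
  let u := density_cdf Omega (w ^~ t) in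
  let uN := empirical_cdf X in
  (Lp_L2_norm P Omega p (fun x s => u x - uN x s)%R <=
   Lp_norm Omega (p / 2%:E) (EFin \o u) `^ 2^-1 / (Num.sqrt N%:R)%:E)%E.
Proof.
cbv zeta; set u := density_cdf _ _; set uN := empirical_cdf _.
have uE k x : P (X k @^-1` [set` `]-oo, x]]) = (u x)%:E.
  exact/esym/density_cdfE.
have mX k x : measurable (X k @^-1` [set` `]-oo, x]]).
  exact: measurable_funPTI.
(* As [N] is positive, there is a first sample [Ordinal hN]; the bounds on [u] and its monotonicity
   are read off from its law. *)
have u0 x : 0 <= u x.
  by rewrite -lee_fin -(uE (Ordinal hN)) measure_ge0.
have u1 x : u x <= 1.
  by rewrite -lee_fin -(uE (Ordinal hN)) probability_le1.
have mu : measurable_fun Omega u.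
  apply: measurable_funTS; apply: nondecreasing_measurable => // x y xy.
  rewrite -lee_fin -!(uE (Ordinal hN)) le_measure ?inE//.
  by apply: preimage_subset; apply: subset_itvl; rewrite bnd_simp.
have EuN x : ('E_P[(fun s => (u x - uN x s) ^+ 2)%R] =
    (u x * (1 - u x) / N%:R)%:E)%E.
  rewrite -(@mean_square_error_frequency _ _ _ P _ _ (u x) hN (mX^~ x) (uE^~ x)).
    congr ('E_P[_])%E; apply/funext => s; rewrite /uN /empirical_cdf.
    congr ((_ - _ * _) ^+ 2); apply: eq_bigr => k _.
    rewrite /heaviside subr_ge0 indicE.
    by case: ifP => Xx; [rewrite mem_set|rewrite memNset];
      rewrite //= in_itv/= Xx.
  (* Pairwise independence is mutual independence for the subfamily [[set j; k]], with the same
     half-line for both samples. *)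
  move=> j k jk.
  have := hind [set j; k]%SET (fun=> [set` `]-oo, x]]) (fun=> measurable_itv _).
  rewrite big_setU1 ?inE//= big_set1 => <-; congr (P _).
  apply/seteqP; split => s.
    by move=> [Aj Ak] i /=; rewrite !inE => /orP[]/eqP ->.
  by move=> AX; split; apply: AX; rewrite /= !inE eqxx ?orbT.
(* Inversion in [\bar R] treats 0 apart, so the positivity of [N] is needed to return to the real
   inverse. *)
have -> : ((Num.sqrt N%:R)%:E^-1 = ((Num.sqrt N%:R)^-1 : R)%:E)%E.
  by rewrite inver gt_eqF// sqrtr_gt0 ltr0n.
rewrite /Lp_L2_norm.
under [X in Lp_norm _ _ X]eq_fun do rewrite EuN.
case: hOmega => /open_measurable mO _ _.
have mE (v : R -> R) : measurable_fun Omega v ->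
    measurable_fun setT ((EFin \o v) \_ Omega).
  move=> mv; apply/measurable_restrict => //; rewrite setTI.
  exact/measurable_EFinP.
apply: Lnorm_le_sqrt.
- apply: (mE (fun x => (u x * (1 - u x) / N%:R) `^ 2^-1)).
  apply: (measurableT_comp (measurable_powR _)).
  apply: measurable_funM => //; apply: measurable_funM => //.
  exact: measurable_funB.
- exact: mE.
- exact: lt_le_trans hp.
- by rewrite invr_ge0 sqrtr_ge0.
(* Outside [Omega] the left side is 0. Inside, [1 - u x <= 1] is dropped under the root, which then
   splits into those of [u x] and [N%:R^-1]. *)
- move=> x; rewrite !patchE; case: ifPn => _; last first.
    by rewrite abse0 mule_ge0 ?poweR_ge0// lee_fin invr_ge0 sqrtr_ge0.
  rewrite /= !ger0_norm ?powR_ge0// lee_fin.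
  rewrite !powR12_sqrt ?divr_ge0 ?mulr_ge0 ?subr_ge0//.
  rewrite -sqrtrV// -sqrtrM// ler_wsqrtr// ler_wpM2r ?invr_ge0//.
  by rewrite ler_piMr// gerBl.
Qed.
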